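(* For each commutative ring $R$ with identity there is a compact $T_4$ topological space $Y$ such that $C(\mathrm{Max}(R))\cong C\left(\mathrm{Max}(C(Y))\right)$ as rings.
   Context: For a commutative ring $R$ with identity, $\mathrm{Max}(R)$ is the set of maximal ideals of $R$ with the Zariski (hull-kernel) topology, whose closed sets are the sets $\{M\in\mathrm{Max}(R): S\subseteq M\}$ for $S\subseteq R$. For a topological space $X$, $C(X)$ is the ring of all real-valued continuous functions on $X$ with pointwise operations. $T_4$ means normal and $T_1$. *)

(* Defs.v *)
From HB Require Import structures.
From mathcomp Require Import all_boot all_order all_algebra.
From mathcomp Require Import all_classical all_reals all_analysis.
Import Order.TTheory GRing.Theory Num.Theory.
Import numFieldNormedType.Exports.

Set Implicit Arguments.
Unset Strict Implicit.
Unset Printing Implicit Defensive.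

Local Open Scope classical_set_scope.
Local Open Scope ring_scope.

(* The library's [idealr] is restricted to nonzero rings, whereas the zero ring
   must be allowed here: it is the ring of continuous functions on the empty
   space. *)
Definition is_ideal (R : comPzRingType) (I : set R) : Prop :=
  [/\ I 0, forall u v, I u -> I v -> I (u + v) & forall a u, I u -> I (a * u)].

Definition is_maximal_ideal (R : comPzRingType) (M : set R) : Prop :=
  [/\ is_ideal M, M <> setT &
      forall J : set R, is_ideal J -> M `<=` J -> J = M \/ J = setT].

Record maxSpec (R : comPzRingType) := MaxSpec {
  max_ideal :> set R;
  max_idealP : is_maximal_ideal max_ideal
}.

HB.instance Definition _ (R : comPzRingType) := gen_eqMixin (maxSpec R).
HB.instance Definition _ (R : comPzRingType) := gen_choiceMixin (maxSpec R).

Definition hull (R : comPzRingType) (S : set R) : set (maxSpec R) :=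
  [set M : maxSpec R | S `<=` M].

Section maximal_is_prime.
Context (R : comPzRingType).
Implicit Type M : maxSpec R.

Lemma maxSpec_not1 M : ~ max_ideal M 1.
Proof.
case: M => M [[_ _ MM] + _] /= M1; apply; apply/seteqP; split=> // x _.
by rewrite -(mulr1 x); exact: MM.
Qed.

Lemma maxSpec_prime M u v :
  max_ideal M (u * v) -> max_ideal M u \/ max_ideal M v.
Proof.
case: (max_idealP M) => -[M0 MD MM] _ Mmax Muv.
pose J := [set x | exists m r, max_ideal M m /\ x = m + r * u].
have MJ : M `<=` J by move=> x Mx; exists x, 0; rewrite mul0r addr0.
have iJ : is_ideal J.
  split; first by exists 0, 0; rewrite mul0r addr0.
  - move=> _ _ [m [r [Mm ->]]] [m' [r' [Mm' ->]]].
    by exists (m + m'), (r + r'); split; [exact: MD | rewrite mulrDl addrACA].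
  - move=> a _ [m [r [Mm ->]]]; exists (a * m), (a * r).
    by split; [exact: MM | rewrite mulrDr mulrA].
have [JM|JT] := Mmax J iJ MJ; [left|right].
  by rewrite -JM; exists 0, 1; rewrite mul1r add0r.
have : J 1 by rewrite JT.
move=> [m [r [Mm E]]]; rewrite -(mul1r v) E mulrDl -mulrA mulrC.
by apply: MD; apply: MM.
Qed.

End maximal_is_prime.

Section zariski.
Context (R : comPzRingType).

Definition zariski_open : set_system (maxSpec R) :=
  [set U | exists S : set R, ~` U = hull S].

Let zariski_openT : zariski_open setT.
Proof.
exists setT; rewrite setCT; apply/seteqP; split=> // M /= hM.
by apply: (@maxSpec_not1 _ M); exact: hM.
Qed.

Let zariski_openI : setI_closed zariski_open.
Proof.
move=> A B [S AS] [T BT].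
exists [set x | exists s t, [/\ S s, T t & x = s * t]].
rewrite setCI AS BT; apply/seteqP; split=> M /=.
  case: (max_idealP M) => -[_ _ MM] _ _.
  case=> h _ [s [t [Ss Tt ->]]]; last exact/MM/h.
  by rewrite mulrC; exact/MM/h.
move=> h; apply: contrapT => /not_orP[/= nS nT].
have [s Ss nMs] : exists2 s, S s & ~ max_ideal M s.
  by apply: contrapT => nex; apply: nS => s Ss; apply: contrapT => ?; apply: nex; exists s.
apply: nT => t Tt; have [//|//] : max_ideal M s \/ max_ideal M t.
by apply: maxSpec_prime; apply: h; exists s, t.
Qed.

Let zariski_open_bigU (J : Type) (f : J -> set (maxSpec R)) :
  (forall i, zariski_open (f i)) -> zariski_open (\bigcup_i f i).
Proof.
move=> /choice[S fS]; exists (\bigcup_i S i).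
rewrite setC_bigcup; apply/seteqP; split=> M /= h.
  by move=> x [i _ Sx]; have := h i I; rewrite fS; exact.
by move=> i _; rewrite fS => x Sx; apply: h; exists i.
Qed.

HB.instance Definition _ := isOpenTopological.Build (maxSpec R)
  zariski_openT zariski_openI zariski_open_bigU.

Lemma closed_maxSpecE (A : set (maxSpec R)) :
  closed A <-> exists S : set R, A = hull S.
Proof.
rewrite -openC; change (open (~` A)) with (zariski_open (~` A)).
by split=> -[S e]; exists S; move: e; rewrite setCK.
Qed.

End zariski.

Definition ctsRing (K : realType) (X : topologicalType) : Type :=
  continuousType X K.

Section ctsRing.
Context (K : realType) (X : topologicalType).

HB.instance Definition _ := Choice.copy (ctsRing K X) (continuousType X K).

Implicit Types f g h : continuousType X K.

Let cts_zero : ctsRing K X := mkcts (fun=> @cst_continuous X K 0 _).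
Let cts_one : ctsRing K X := mkcts (fun=> @cst_continuous X K 1 _).

Let opp_cts f : continuous (fun x => - f x).
Proof. by move=> x; apply: cvgN; exact: cts_fun. Qed.
Let add_cts f g : continuous (fun x => f x + g x).
Proof. by move=> x; apply: cvgD; exact: cts_fun. Qed.
Let mul_cts f g : continuous (fun x => f x * g x).
Proof. by move=> x; apply: cvgM; exact: cts_fun. Qed.

Let cts_opp (f : ctsRing K X) : ctsRing K X := mkcts (@opp_cts f).
Let cts_add (f g : ctsRing K X) : ctsRing K X := mkcts (@add_cts f g).
Let cts_mul (f g : ctsRing K X) : ctsRing K X := mkcts (@mul_cts f g).

Let addA : associative cts_add.
Proof. by move=> f g h; apply/continuousEP => x; exact: addrA. Qed.
Let addC : commutative cts_add.
Proof. by move=> f g; apply/continuousEP => x; exact: addrC. Qed.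
Let add0 : left_id cts_zero cts_add.
Proof. by move=> f; apply/continuousEP => x; exact: add0r. Qed.
Let addN : left_inverse cts_zero cts_opp cts_add.
Proof. by move=> f; apply/continuousEP => x; exact: addNr. Qed.

HB.instance Definition _ :=
  GRing.isZmodule.Build (ctsRing K X) addA addC add0 addN.

Let mulA : associative cts_mul.
Proof. by move=> f g h; apply/continuousEP => x; exact: mulrA. Qed.
Let mulC : commutative cts_mul.
Proof. by move=> f g; apply/continuousEP => x; exact: mulrC. Qed.
Let mul1 : left_id cts_one cts_mul.
Proof. by move=> f; apply/continuousEP => x; exact: mul1r. Qed.
Let mulD : left_distributive cts_mul +%R.
Proof. by move=> f g h; apply/continuousEP => x; exact: mulrDl. Qed.

HB.instance Definition _ :=
  GRing.Zmodule_isComPzRing.Build (ctsRing K X) mulA mulC mul1 mulD.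

End ctsRing.

Definition ring_isomorphic (A B : pzRingType) : Prop :=
  exists f : {rmorphism A -> B}, bijective f.

Definition T4_space (X : topologicalType) : Prop :=
  @normal_space X /\ @accessible_space X.

(* Main.v *)
Require Import Defs.
From HB Require Import structures.
From mathcomp Require Import all_boot all_order all_algebra.
From mathcomp Require Import all_classical all_reals all_analysis.

(** For an arbitrary compact space [X], Hausdorff or not, the rings [C(X)] and
    [C(Max(C(X)))] are isomorphic ([ctsRing_gelfand_iso]). By compactness every
    maximal ideal of [C(X)] is the set of functions vanishing at some point
    ([maxSpec_point]), so that [x |-> {f | f x = 0}] is a continuous surjection
    from [X] onto [Max(C(X))] identifying exactly the points which no
    continuous function separates. Every [f] in [C(X)] factors through that
    surjection, and its factor is continuous for the Zariski topology
    ([gelfand_continuous]): the set where the factor exceeds [a] consists of the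
    maximal ideals that do not contain [max(f - a, 0)].

    The factors of the functions [f] separate the points of [Max(C(X))], which
    is therefore Hausdorff ([hausdorff_maxSpec]). The space of maximal ideals of
    any commutative ring is compact ([compact_maxSpec]), hence
    [Y := Max(C(Max(R)))] is compact Hausdorff, so normal and T1. Applying the
    isomorphism to the compact space [Max(R)] and then to [Y] gives
    [C(Max(R)) = C(Y) = C(Max(C(Y)))] up to isomorphism. *)

Import Order.TTheory GRing.Theory Num.Theory.
Import numFieldNormedType.Exports.

Set Implicit Arguments.
Unset Strict Implicit.
Unset Printing Implicit Defensive.

Local Open Scope classical_set_scope.
Local Open Scope ring_scope.

Lemma maxSpec_eq (R : comPzRingType) (M N : maxSpec R) :
  max_ideal M `<=` max_ideal N -> M = N.
Proof.
case: M N => [M Mmax] [N Nmax] /= MN.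
have NM : N = M.
  case: Nmax Mmax => iN NT _ [_ _ Mmax].
  by have [//|/NT] := Mmax N iN MN.
by subst N; congr MaxSpec; exact: Prop_irrelevance.
Qed.

(** Krull's theorem. Properness is stated as [~ I 1] so that the zero ring,
    which has no proper ideal, is covered. *)
Lemma proper_ideal_sub_maxSpec (R : comPzRingType) (I : set R) :
  is_ideal I -> ~ I 1 -> exists M : maxSpec R, I `<=` max_ideal M.
Proof.
move=> [I0 ID IM] I1.
(* Zorn's lemma must also be fed the empty chain, whose union is empty; the
   predicate is therefore put on the union of [I] and [J], so that the empty
   set satisfies it. *)
pose P (J : set R) := is_ideal (I `|` J) /\ ~ (I `|` J) 1.
have Pchain (F : set (set R)) :
    F `<=` P -> total_on F subset -> P (\bigcup_(J in F) J).
  move=> FP Ftot; split; [split|].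
  - by left.
  - move=> u v [Iu|[J FJ Ju]] [Iv|[L FL Lv]].
    + by left; exact: ID.
    + have [[_ LD _] _] := FP _ FL.
      by have [|?] := LD u v (or_introl Iu) (or_intror Lv);
        [left|right; exists L].
    + have [[_ JD _] _] := FP _ FJ.
      by have [|?] := JD u v (or_intror Ju) (or_introl Iv);
        [left|right; exists J].
    + have [/(_ _ Ju) Lu|/(_ _ Lv) Jv] := Ftot _ _ FJ FL.
      * have [[_ LD _] _] := FP _ FL.
        by have [|?] := LD u v (or_intror Lu) (or_intror Lv);
          [left|right; exists L].
      * have [[_ JD _] _] := FP _ FJ.
        by have [|?] := JD u v (or_intror Ju) (or_intror Jv);
          [left|right; exists J].
  - move=> a u [Iu|[J FJ Ju]]; first by left; exact: IM.
    have [[_ _ JM] _] := FP _ FJ.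
    by have [|?] := JM a u (or_intror Ju); [left|right; exists J].
  - by move=> [//|[J FJ J1]]; have [_] := FP _ FJ; apply; right.
have [A [[iA A1] Amax]] := Zorn_bigcup Pchain.
have maxA : is_maximal_ideal (I `|` A).
  split=> //; first by move=> AT; apply: A1; rewrite AT.
  move=> J iJ AJ; have [J1|J1] := pselect (J 1).
    right; apply/seteqP; split=> // x _.
    by case: iJ => _ _ JM; rewrite -(mulr1 x); exact: JM.
  left; have IJ : I `|` J = J by apply: setUidr => x Ix; apply: AJ; left.
  have AsubJ : A `<=` J by move=> x Ax; apply: AJ; right.
  have JA : J `<=` A.
    apply: contrapT => nJA; apply: (Amax J); last by rewrite /P IJ.
    by split.
  by rewrite -IJ; congr (_ `|` _); apply/seteqP.
by exists (MaxSpec maxA) => x Ix; left.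
Qed.

(** For a proper filter [F], the elements lying in [F]-almost every maximal
    ideal form a proper ideal; a maximal ideal containing it is a cluster point,
    because the closure of a set in [F] is the hull of elements of that
    ideal. *)
Lemma compact_maxSpec (R : comPzRingType) : compact [set: maxSpec R].
Proof.
move=> F FF _.
pose I : set R := [set r | F [set M : maxSpec R | max_ideal M r]].
have iI : is_ideal I.
  split.
  - by apply: filterS filterT => M _; case: (max_idealP M) => -[].
  - move=> u v Iu Iv; apply: filterS (filterI Iu Iv) => M [Mu Mv].
    by case: (max_idealP M) => -[_ MD _] _ _; exact: MD.
  - move=> a u; apply: filterS => M.
    by case: (max_idealP M) => -[_ _ MM] _ _; exact: MM.
have I1 : ~ I 1.
  move=> F1; apply: (@filter_not_empty _ F _); apply: filterS F1 => M.
  exact: maxSpec_not1.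
have [M IM] := proper_ideal_sub_maxSpec iI I1.
exists M; split=> //; rewrite clusterE => A FA.
have /closed_maxSpecE[S AS] := @closed_closure _ A.
rewrite AS => r Sr; apply: IM; apply: filterS FA => N /subset_closure.
by rewrite AS; apply.
Qed.

Lemma maxSpec_basic_open (R : comPzRingType) (r : R) :
  open [set M : maxSpec R | ~ max_ideal M r].
Proof.
suff : closed [set M : maxSpec R | max_ideal M r] by move/closed_openC.
apply/closed_maxSpecE; exists [set r].
by apply/seteqP; split=> M /=; [move=> Mr _ -> | exact].
Qed.

(** The open rays form a subbase of the topology of the reals. Rays are the
    right sets to test, because their preimages under a function on
    [Max(C(X))] coming from [C(X)] are basic Zariski open sets. *)
Lemma continuous_rays (K : realType) (X : topologicalType) (f : X -> K) :
  (forall a, open [set x | a < f x]) -> (forall a, open [set x | f x < a]) ->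
  continuous f.
Proof.
move=> fgt flt x; apply/cvgrPdist_lt => e e0.
have xgt : nbhs x [set y | f x - e < f y].
  by apply: open_nbhs_nbhs; split=> //=; rewrite gtrBl.
have xlt : nbhs x [set y | f y < f x + e].
  by apply: open_nbhs_nbhs; split=> //=; rewrite ltrDl.
apply: filterS (filterI xgt xlt) => y [/= gt lt].
by rewrite distrC ltr_distl gt lt.
Qed.

Section gelfand_duality.
Context (K : realType) (X : topologicalType).
Implicit Types (f g : ctsRing K X) (x : X) (M : maxSpec (ctsRing K X)).

Definition cst_cts (c : K) : ctsRing K X :=
  mkcts (fun=> @cst_continuous X K c _).

Lemma positive_part_continuous f (a : K) :
  continuous (fun x => Num.max (f x - a) 0).
Proof.
move=> x; apply: (@continuous_max _ X (fun x => f x - a) (fun=> 0)).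
  by apply: cvgB; [exact: cts_fun | exact: cvg_cst].
exact: cvg_cst.
Qed.

Definition positive_part f a : ctsRing K X :=
  mkcts (@positive_part_continuous f a).

Lemma zero_free_unit f : (forall x, f x != 0) -> exists g, g * f = 1.
Proof.
move=> f0; have fV : continuous (fun x => (f x)^-1).
  by move=> x; apply: cvgV; [exact: f0 | exact: cts_fun].
exists (mkcts fV : ctsRing K X); apply/continuousEP => x.
exact: mulVf (f0 x).
Qed.

Lemma vanishing_maximal x : is_maximal_ideal [set f : ctsRing K X | f x = 0].
Proof.
split.
- split=> //= [f g f0 g0|a f f0].
    by change (f x + g x = 0); rewrite f0 g0 addr0.
  by change (a x * f x = 0); rewrite f0 mulr0.
- move=> V; have : [set f : ctsRing K X | f x = 0] 1 by rewrite V.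
  by apply/eqP; exact: oner_neq0.
- move=> J [J0 JD JM] VJ.
  have [[f [Jf fx]]|nJ] := pselect (exists f, J f /\ f x != 0); last first.
    left; apply/seteqP; split=> // f Jf; apply: contrapT => /eqP fx.
    by apply: nJ; exists f.
  right; apply/seteqP; split=> // g _.
  (* A constant multiple of [f] agrees with [g] at [x]; it is in [J], and its
     difference with [g] vanishes at [x]. *)
  pose c := cst_cts (g x / f x).
  have -> : g = c * f + (g - c * f) by rewrite addrC subrK.
  apply: JD; first exact: JM.
  by apply: VJ; change (g x - g x / f x * f x = 0); rewrite divfK// subrr.
Qed.

Definition point_ideal x : maxSpec (ctsRing K X) :=
  MaxSpec (vanishing_maximal x).

Lemma point_ideal_continuous : continuous point_ideal.
Proof.
apply/continuous_closedP => A /closed_maxSpecE[S ->].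
have -> : point_ideal @^-1` hull S = \bigcap_(f in S) (f @^-1` [set 0]).
  by apply/seteqP; split=> x; exact.
apply: closed_bigI => f _; apply: preimage_closed.
  by move=> x _; exact: cts_fun.
exact: closed_eq.
Qed.

Hypothesis cX : compact [set: X].

(** The zero sets of the elements of [M] generate a proper filter: two of them
    meet in the zero set of [f ^ 2 + g ^ 2], and none is empty since a zero-free
    function is a unit. As zero sets are closed, all elements of [M] vanish at
    any cluster point of this filter. *)
Lemma maxSpec_point M : exists x, M = point_ideal x.
Proof.
case: (max_idealP M) => -[M0 MD MM] _ _.
pose Z f := [set x | f x = 0].
pose F : set_system X := [set A | exists2 f, max_ideal M f & Z f `<=` A].
have FF : ProperFilter F.
  split; last split.
  - move=> [f Mf Zf].
    have [|g gf1] := @zero_free_unit f.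
      by move=> x; apply/eqP => fx; exact: (Zf x).
    by apply: (@maxSpec_not1 _ M); rewrite -gf1; exact: MM.
  - by exists 0.
  - move=> A B [f Mf fA] [g Mg gB].
    exists (f * f + g * g); first by apply: MD; exact: MM.
    move=> x; change (f x * f x + g x * g x = 0 -> (A `&` B) x).
    rewrite -!expr2 => /eqP; rewrite paddr_eq0 ?sqr_ge0// !sqrf_eq0.
    by move=> /andP[/eqP fx /eqP gx]; split; [exact: fA | exact: gB].
  - by move=> A B AB [f Mf fA]; exists f => // x /fA/AB.
have [x [_ Fx]] := cX FF filterT.
exists x; apply: maxSpec_eq => f Mf.
have Zf : closed (Z f).
  apply: (@preimage_closed _ _ f [set 0]) => [y _|]; first exact: cts_fun.
  exact: closed_eq.
by apply: Zf; move: Fx; rewrite clusterE; apply; exists f.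
Qed.

(** Points that no continuous function separates give the same maximal ideal,
    so this is only a chosen section of [point_ideal], which need not be
    continuous; composing it with a continuous function nevertheless gives a
    continuous function. *)
Definition zero_point M : X := sval (cid (maxSpec_point M)).

Lemma zero_pointP M f : max_ideal M f <-> f (zero_point M) = 0.
Proof. by rewrite /zero_point; case: cid => x /= ->. Qed.

Lemma zero_pointK M : point_ideal (zero_point M) = M.
Proof. by rewrite /zero_point; case: cid => x /= ->. Qed.

Lemma zero_point_ideal f x : f (zero_point (point_ideal x)) = f x.
Proof.
apply/eqP; rewrite -subr_eq0; apply/eqP.
have : max_ideal (point_ideal x) (f - cst_cts (f x)) by exact: subrr.
by move/zero_pointP.
Qed.

(** [f - a] is positive at a point exactly when its positive part does not
    vanish there, which turns an order condition into a basic Zariski open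
    set. *)
Lemma gelfand_gt f a : open [set M | a < f (zero_point M)].
Proof.
have -> : [set M | a < f (zero_point M)] =
          [set M | ~ max_ideal M (positive_part f a)].
  apply/seteqP; split=> M /=; rewrite zero_pointP.
    move=> fa; change (Num.max (f (zero_point M) - a) 0 <> 0).
    by rewrite max_l ?subr_ge0 1?ltW//; apply/eqP; rewrite subr_eq0 gt_eqF.
  change (Num.max (f (zero_point M) - a) 0 <> 0 -> a < f (zero_point M)).
  by rewrite ltNge => h; apply/negP => le; apply: h; rewrite max_r// subr_le0.
exact: maxSpec_basic_open.
Qed.

Lemma gelfand_continuous f : continuous (f \o zero_point).
Proof.
apply: continuous_rays => a; first exact: gelfand_gt.
have -> : [set M | (f \o zero_point) M < a] =
          [set M | - a < (- f : ctsRing K X) (zero_point M)].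
  by apply/seteqP; split=> M /=; rewrite ltrN2.
exact: gelfand_gt.
Qed.

Definition gelfand f : ctsRing K (maxSpec (ctsRing K X)) :=
  mkcts (@gelfand_continuous f).

Lemma gelfand_additive : zmod_morphism gelfand.
Proof. by move=> f g; apply/continuousEP. Qed.

Lemma gelfand_multiplicative : monoid_morphism gelfand.
Proof. by split=> [|f g]; apply/continuousEP. Qed.

HB.instance Definition _ :=
  GRing.isZmodMorphism.Build _ _ gelfand gelfand_additive.
HB.instance Definition _ :=
  GRing.isMonoidMorphism.Build _ _ gelfand gelfand_multiplicative.

(** The inverse of [gelfand] is the pullback along [point_ideal]. *)
Lemma ctsRing_gelfand_iso :
  ring_isomorphic (ctsRing K X) (ctsRing K (maxSpec (ctsRing K X))).
Proof.
exists gelfand.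
have pullback_continuous (h : ctsRing K (maxSpec (ctsRing K X))) :
    continuous (h \o point_ideal).
  by move=> x; apply: continuous_comp;
    [exact: point_ideal_continuous | exact: cts_fun].
exists (fun h => mkcts (@pullback_continuous h) : ctsRing K X).
- by move=> f; apply/continuousEP => x; exact: zero_point_ideal.
- by move=> h; apply/continuousEP => M; congr (h _); exact: zero_pointK.
Qed.

(** If [f] lies in [M], its Gelfand transform is zero at [M], hence also at any
    [N] that cannot be separated from [M], since the reals are Hausdorff; thus
    [M] is contained in [N]. *)
Lemma hausdorff_maxSpec : hausdorff_space (maxSpec (ctsRing K X)).
Proof.
move=> M N MN; apply: maxSpec_eq => f /zero_pointP fM; apply/zero_pointP.
rewrite -fM; apply/esym/(@Rhausdorff K) => A B fMA fNB.
have [] := MN ((f \o zero_point) @^-1` A) ((f \o zero_point) @^-1` B).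
- exact: gelfand_continuous.
- exact: gelfand_continuous.
- by move=> L [AL BL]; exists (f (zero_point L)).
Qed.

End gelfand_duality.

Lemma ring_isomorphic_trans (A B C : pzRingType) :
  ring_isomorphic A B -> ring_isomorphic B C -> ring_isomorphic A C.
Proof.
move=> [f fbij] [g gbij]; exists (g \o f : {rmorphism A -> C}).
exact: bij_comp.
Qed.

Theorem theorem4p17 (K : realType) (R : comPzRingType) :
  exists Y : topologicalType,
    [/\ compact [set: Y]%classic, T4_space Y &
        ring_isomorphic (ctsRing K (maxSpec R))
                        (ctsRing K (maxSpec (ctsRing K Y)))].
Proof.
have cX := @compact_maxSpec R.
pose Y : topologicalType := maxSpec (ctsRing K (maxSpec R)).
have cY : compact [set: Y] by exact: compact_maxSpec.
have hY : hausdorff_space Y by exact: hausdorff_maxSpec.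
exists Y; split=> //.
- by split; [exact: compact_normal | exact: hausdorff_accessible].
- exact: ring_isomorphic_trans (ctsRing_gelfand_iso K cX)
    (ctsRing_gelfand_iso K cY).
Qed.
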